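(* Let $A\in\mathbf{R}^{n\times n}$ be symmetric positive definite, $b\in\mathbf{R}^n$, let $P^{-1}\in\mathbf{R}^{n\times n}$ be nonsingular, fix $\ell\in\{0,\tfrac12,1,\tfrac32,2,\tfrac52,3,\dots\}$ and $\omega\in(0,2)$. Given an initial point $x_0\in\mathbf{R}^n$, let the iterates $(x_k)_{k\ge0}$ be generated by the Flexible Scheme, i.e. for all $k\ge0$ $$x_{k+1}=x_k-\omega P^{-1}W_ka_k,$$ where $1\le m_k\le n$, $W_k\in\mathbf{R}^{n\times m_k}$ has full rank (linearly independent columns), $g(z_k)\in\mathrm{col}(W_k)$ with $z_k=P^{-T}x_k$, and $$a_k=\left(W_k^TP^{-T}\tilde A^{2\ell+1}P^{-1}W_k\right)^{-1}W_k^TP^{-T}\tilde A^{2\ell}\tilde g_k.$$ Then for all $k\ge0$, $$\|\tilde g_{k+1}\|^2_{\tilde A^{2\ell-1}}\le (c(\omega))^k\,\|\tilde g_0\|^2_{\tilde A^{2\ell-1}},\qquad\text{where}\quad c(\omega)=1-\omega(2-\omega)\frac{4\tilde\kappa}{(\tilde\kappa+1)^2}.$$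
   Context: The problem is to minimize $f(z)=\tfrac12 z^TAz-z^Tb$ over $z\in\mathbf{R}^n$. The gradient is $g(z)=\nabla f(z)=Az-b$. Preconditioned quantities: $P$ is the inverse of $P^{-1}$, $P^{-T}=(P^{-1})^T$, $\tilde A=P^{-1}AP^{-T}$ (symmetric positive definite), $\tilde b=P^{-1}b$, variables are related by $z=P^{-T}x$, and $\tilde g_k=P^{-1}(AP^{-T}x_k-b)=\tilde A x_k-\tilde b=P^{-1}g(z_k)$. The eigenvalues of $\tilde A$ are $0<\tilde\lambda_n\le\cdots\le\tilde\lambda_1$ and $\tilde\kappa=\tilde\lambda_1/\tilde\lambda_n$ is its condition number. For a symmetric positive definite matrix $B$, $\|v\|_B=\sqrt{v^TBv}$. Since $2\ell$ is a nonnegative integer, all powers of $\tilde A$ are integer powers, with $\tilde A^0=I$. The convention $0^0=1$ is used. *)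

(* Defs.v *)
(* MathComp; the real field is an arbitrary R : realType. *)
From mathcomp Require Import all_boot all_order all_algebra.
From mathcomp Require Import classical_sets reals.

Set Implicit Arguments.
Unset Strict Implicit.
Unset Printing Implicit Defensive.

Import Order.TTheory GRing.Theory Num.Theory.
Local Open Scope classical_set_scope.
Local Open Scope ring_scope.

Definition spd (R : realType) n (B : 'M[R]_n) : Prop :=
  B^T = B /\ forall v : 'cV[R]_n, v != 0 -> 0 < (v^T *m B *m v) 0 0.

Definition norm_mx (R : realType) n (B : 'M[R]_n) (v : 'cV[R]_n) : R :=
  Num.sqrt ((v^T *m B *m v) 0 0).

(* The set of eigenvalues of a matrix is finite, so the supremum and infimum
   are its greatest and least elements as soon as there is a real eigenvalue,
   which is the case for every symmetric matrix of size at least 1. *)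
Definition eig_max (R : realType) n (B : 'M[R]_n) : R :=
  sup [set a : R | eigenvalue B a].

Definition eig_min (R : realType) n (B : 'M[R]_n) : R :=
  inf [set a : R | eigenvalue B a].

Definition cond_num (R : realType) n (B : 'M[R]_n) : R :=
  eig_max B / eig_min B.

(* Gradient of z |-> 1/2 z^T A z - z^T b, for A symmetric. *)
Definition grad (R : realType) n (A : 'M[R]_n) (b z : 'cV[R]_n) : 'cV[R]_n :=
  A *m z - b.

(* [Q] stands for the preconditioner P^-1, so that P^-T is [Q^T]. *)
Definition precond (R : realType) n (A Q : 'M[R]_n) : 'M[R]_n :=
  Q *m A *m Q^T.

Definition precond_grad (R : realType) n (A Q : 'M[R]_n) (b x : 'cV[R]_n) :
    'cV[R]_n :=
  precond A Q *m x - Q *m b.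

(* The natural number [l2] is 2l, where l is in {0, 1/2, 1, 3/2, ...}. *)
Definition flex_coef (R : realType) n (A Q : 'M[R]_n.+1) (b : 'cV[R]_n.+1)
    (l2 : nat) m (W : 'M[R]_(n.+1, m)) (x : 'cV[R]_n.+1) : 'cV[R]_m :=
  let At := precond A Q in
  invmx (W^T *m Q^T *m At ^+ l2.+1 *m Q *m W)
    *m (W^T *m Q^T *m At ^+ l2 *m precond_grad A Q b x).

(* MathComp's row-space inclusion, applied to transposes, says that the
   gradient at z_k = P^-T x_k lies in the column space of W_k. *)
Definition flexible_scheme (R : realType) n (A Q : 'M[R]_n.+1)
    (b : 'cV[R]_n.+1) (l2 : nat) (omega : R) (m : nat -> nat)
    (W : forall k, 'M[R]_(n.+1, m k)) (x : nat -> 'cV[R]_n.+1) : Prop :=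
  forall k,
    [/\ (1 <= m k <= n.+1)%N,
        \rank (W k) = m k,
        ((grad A b (Q^T *m x k))^T <= (W k)^T)%MS
      & x k.+1 = x k - omega *: (Q *m W k *m flex_coef A Q b l2 (W k) (x k))].

Definition conv_factor (R : realType) (kappa omega : R) : R :=
  1 - omega * (2 - omega) * (4 * kappa / (kappa + 1) ^+ 2).

(* Main.v *)
Require Import Defs.
From mathcomp Require Import all_boot all_order all_algebra.
From mathcomp Require Import boolp classical_sets reals.
From mathcomp Require Import complex polyrcf ring lra.

(** Write [B] for the preconditioned matrix and [H] for [B ^ (2l + 1)], and
    measure the iterate [x_k] by its error [e_k = B^-1 gt_k], which is the
    difference between [x_k] and the minimizer.  Two facts make the theorem a
    statement about projections.  The norm to bound is the norm of the error
    for the scalar product of [H]: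
      [gt_k^T B^(2l - 1) gt_k = e_k^T H e_k].
    And with [V = Q W_k] the update is
      [e_(k+1) = e_k - omega s],
    where [s = V (V^T H V)^-1 V^T H e_k] is the [H]-orthogonal projection of
    [e_k] onto the column space of [V].

    By Pythagoras, [|e_(k+1)|^2 = |e_k|^2 - omega (2 - omega) |s|^2] in the
    norm of [H].  The condition that the gradient lies in the column space of
    [W_k] says that [B e_k] lies in the column space of [V]; so [e_k] and [s]
    have the same scalar product with [B e_k], and the Cauchy-Schwarz
    inequality gives [|s|^2 |B e_k|^2 >= <e_k, B e_k>^2]
    (relaxed_projection).

    It remains to bound [<e, B e>^2] below by a multiple of
    [|e|^2 |B e|^2], that is, to compare the moments [e^T B^j e] for three
    consecutive exponents [j].  This is Kantorovich's inequality (kantorovich).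
    If [l] and [L] are the extreme eigenvalues of [B], the polynomial
    [X^j (L - X) (X - l)] is nonnegative on the spectrum, hence so is the
    quadratic form of its value at [B] (bform_horner_ge0), and the inequality
    of arithmetic and geometric means finishes.

    Together these bound each step by the factor [c] (projection_contraction).
    After [k + 1] steps the factor is [c ^ (k + 1)], which is at most [c ^ k]
    because [0 <= c <= 1]. *)

Set Implicit Arguments.
Unset Strict Implicit.
Unset Printing Implicit Defensive.

Import Order.TTheory GRing.Theory Num.Theory.
Local Open Scope ring_scope.

(** * Bilinear forms and positive definite matrices *)

Definition bform (R : pzRingType) n (B : 'M[R]_n) (u v : 'cV[R]_n) : R :=
  (u^T *m B *m v) 0 0.

Lemma bform_sym (R : comPzRingType) n (B : 'M[R]_n) u v :
  B^T = B -> bform B u v = bform B v u.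
Proof.
move=> symB; rewrite /bform -[in LHS](trmxK (_ *m v)) mxE.
by rewrite !trmx_mul trmxK symB mulmxA.
Qed.

Lemma bform_subZ (R : comPzRingType) n (B : 'M[R]_n) u v t : B^T = B ->
  bform B (u - t *: v) (u - t *: v) =
  bform B u u - 2 * t * bform B u v + t ^+ 2 * bform B v v.
Proof.
move=> symB; have := bform_sym v u symB; rewrite /bform.
have -> : (u - t *: v)^T = u^T - t *: v^T by rewrite linearB linearZ.
rewrite !(mulmxBl, mulmxBr) -!(scalemxAl, scalemxAr) !mxE => ->.
ring.
Qed.

Lemma mul_trmx_gt0 (R : realDomainType) n (v : 'cV[R]_n) :
  v != 0 -> 0 < (v^T *m v) 0 0.
Proof.
move=> v0; have [i vi0] : exists i, v i 0 != 0.
  apply/existsP; apply: contraR v0 => /existsPn v0.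
  by apply/eqP/colP => i; rewrite mxE; apply/eqP; move: (v0 i); rewrite negbK.
rewrite mxE (bigD1 i) //= ltr_wpDr //.
  by apply: sumr_ge0 => j _; rewrite mxE -expr2 sqr_ge0.
by rewrite mxE -expr2 exprn_even_gt0.
Qed.

Lemma bform_gt0 (R : realType) n (B : 'M[R]_n) v :
  spd B -> v != 0 -> 0 < bform B v v.
Proof. by case=> _; apply. Qed.

Lemma bform_ge0 (R : realType) n (B : 'M[R]_n) v : spd B -> 0 <= bform B v v.
Proof.
move=> spdB; have [->|/(bform_gt0 spdB)/ltW//] := eqVneq v 0.
by rewrite /bform mulmx0 mxE.
Qed.

Lemma bform_CauchySchwarz (R : realType) n (B : 'M[R]_n) u v : spd B ->
  bform B u v ^+ 2 <= bform B u u * bform B v v.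
Proof.
move=> spdB; have [->|v0] := eqVneq v 0.
  by rewrite /bform !mulmx0 !mxE mulr0 expr0n.
have vv_gt0 := bform_gt0 spdB v0.
(* This multiple of v is the projection of u onto the line of v. *)
have := bform_ge0 (u - (bform B u v / bform B v v) *: v) spdB.
rewrite bform_subZ ?spdB.1 // -(pmulr_lge0 _ vv_gt0) => h.
rewrite -subr_ge0; apply: le_trans h _; rewrite le_eqVlt; apply/orP; left.
by apply/eqP; field; rewrite gt_eqF.
Qed.

Lemma spd_unitmx (R : realType) n (B : 'M[R]_n) : spd B -> B \in unitmx.
Proof.
move=> spdB; rewrite -row_free_unit; apply: inj_row_free => v vB0.
apply: trmx_inj; rewrite trmx0; apply/eqP; apply: contraT => /(bform_gt0 spdB).
by rewrite /bform trmxK vB0 mul0mx mxE ltxx.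
Qed.

Lemma spd_congr (R : realType) n m (B : 'M[R]_n) (V : 'M[R]_(n, m)) :
  spd B -> \rank V = m -> spd (V^T *m B *m V).
Proof.
move=> spdB rkV; split=> [|v v0].
  by rewrite !trmx_mul trmxK spdB.1 mulmxA.
have : V *m v != 0.
  apply: contraNneq v0 => Vv0; apply/eqP; apply: trmx_inj; rewrite trmx0.
  apply: (@row_free_inj _ _ _ _ V^T); first by rewrite /row_free mxrank_tr rkV.
  by rewrite -trmx_mul Vv0 trmx0 mul0mx.
by move=> /(bform_gt0 spdB); rewrite /bform trmx_mul !mulmxA.
Qed.

(** Congruence by [B] raises the exponent by 2, so the powers reduce to
    [B ^+ 0] and [B ^+ 1] without any diagonalization. *)
Lemma spd_exp (R : realType) n (B : 'M[R]_n.+1) j : spd B -> spd (B ^+ j).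
Proof.
move=> spdB; have [k] := ubnP j; elim: k j => // k IH [_|[_|j jk]].
- by rewrite expr0; split=> [|v /mul_trmx_gt0]; rewrite ?trmx1 ?mulmx1.
- by rewrite expr1.
have -> : B ^+ j.+2 = B^T *m B ^+ j *m B by rewrite exprS exprSr mulrA spdB.1.
apply: spd_congr; last by rewrite mxrank_unit ?spd_unitmx.
by apply: IH; apply: ltn_trans (ltnSn _) _.
Qed.

Lemma spd_precond (R : realType) n (A Q : 'M[R]_n.+1) :
  spd A -> Q \in unitmx -> spd (precond A Q).
Proof.
move=> spdA unitQ; rewrite /precond -{1}[Q]trmxK; apply: spd_congr => //.
by rewrite mxrank_tr mxrank_unit.
Qed.

(** The exponent [j - 1] may be [-1]; multiplying on both sides by [B] turns
    it into the natural number [j.+1]. *)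
Lemma norm_mx_expz (R : realType) n (B : 'M[R]_n.+1) (j : nat) g : spd B ->
  norm_mx (B ^ (j%:Z - 1)) g ^+ 2
    = bform (B ^+ j.+1) (invmx B *m g) (invmx B *m g).
Proof.
move=> spdB; have unitB := spd_unitmx spdB.
have defN : B ^ (j%:Z - 1) = invmx B *m B ^+ j.+1 *m invmx B.
  by rewrite exprS mulKmx // exprzDr.
have eqN : bform (B ^ (j%:Z - 1)) g g =
    bform (B ^+ j.+1) (invmx B *m g) (invmx B *m g).
  by rewrite defN /bform trmx_mul trmx_inv spdB.1 !mulmxA.
rewrite -eqN /norm_mx sqr_sqrtr // -[X in 0 <= X]/(bform _ _ _) eqN.
exact/bform_ge0/spd_exp.
Qed.

(** * Polynomials in a symmetric matrix *)

(** Over the complex numbers [B] is diagonalized by a unitary matrix [P].  Its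
    diagonal entries are real, so they are eigenvalues of [B] itself, and the
    form is the sum of the [p.[d i] * |w i|^2] with [w = P v]. *)
Lemma bform_horner_ge0 (R : rcfType) n (B : 'M[R]_n.+1) (p : {poly R}) :
    B^T = B -> (forall a, eigenvalue B a -> 0 <= p.[a]) ->
  forall v, 0 <= bform (horner_mx B p) v v.
Proof.
move=> symB p_ge0 v.
pose f : {rmorphism R -> complex R} := real_complex R; pose C := map_mx f B.
have realC : C \is a mxOver Num.real.
  by apply/mxOverP => i j; rewrite mxE; apply/complex_realP; exists (B i j).
have symC : C \is symmetricmx.
  by apply/is_hermitianmxP; rewrite expr0 scale1r map_mx_id // map_trmx symB.
have hermC := realsym_hermsym symC realC.
have defC := orthomx_spectralP (hermitian_normalmx hermC).
set P := spectralmx C in defC; set d := spectral_diag C in defC.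
have unitP : P \in unitmx by apply: spectral_unit.
(* The rows of P are eigenvectors. *)
have d_eig i : eigenvalue C (d 0 i).
  apply/eigenvalueP; exists (row i P); last first.
    apply: contraTneq unitP => P0; rewrite -row_free_unit -kermx_eq0.
    apply/rowV0Pn; exists (delta_mx 0 i).
      by rewrite sub_kermx -rowE P0.
    by apply/eqP => /matrixP/(_ 0 i)/eqP; rewrite !mxE !eqxx oner_eq0.
  rewrite [X in _ *m X]defC !mulmxA -row_mul mulmxV // row1 -rowE row_diag_mx.
  by rewrite -scalemxAl -rowE.
pose w := P *m map_mx f v.
suff: f 0 <= f (bform (horner_mx B p) v v) by rewrite lecR.
rewrite rmorph0.
suff -> : f (bform (horner_mx B p) v v) =
    \sum_i (map_poly f p).[d 0 i] * (w i 0 * (w i 0)^*).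
  apply: sumr_ge0 => i _; rewrite mulr_ge0 ?mul_conjC_ge0 //.
  have /mxOverP/(_ 0 i)/complex_realP[r dr] := hermitian_spectral_diag_real hermC.
  have := d_eig i; rewrite dr eigenvalue_map => /p_ge0.
  by rewrite horner_map /= -(rmorph0 f) lecR.
have -> : f (bform (horner_mx B p) v v) =
    (map_mx f (v^T *m horner_mx B p *m v)) 0 0 by rewrite mxE.
rewrite !map_mxM -map_trmx map_horner_mx -/C defC horner_mx_uconjC //.
rewrite horner_mx_diag invmx_unitary ?spectral_unitarymx // -/P -/d.
have fvC : map_mx f v = map_mx Num.conj (map_mx f v).
  apply/matrixP=> i j; rewrite !mxE; apply/esym/conj_Creal/complex_realP.
  by exists (v i j).
rewrite !mulmxA.
have <- : map_mx Num.conj w^T = (map_mx f v)^T *m map_mx Num.conj P^T.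
  by rewrite trmx_mul map_mxM; congr (_ *m _); rewrite -map_trmx -fvC.
rewrite -mulmxA -/w mxE; apply: eq_bigr => i _.
by rewrite mul_mx_diag !mxE mulrC mulrA mulrC mulrA.
Qed.

(** * Extreme eigenvalues *)

Lemma eigenvalue_bounded (R : realFieldType) n (B : 'M[R]_n) a :
  eigenvalue B a -> `|a| <= cauchy_bound (char_poly B).
Proof.
rewrite eigenvalue_root_char => /rootP Ba; apply/ltW/cauchy_boundP => //.
by rewrite -size_poly_gt0 size_char_poly.
Qed.

Lemma eig_max_ge (R : realType) n (B : 'M[R]_n) a :
  eigenvalue B a -> a <= eig_max B.
Proof.
move=> Ba; apply: ub_le_sup => //; exists (cauchy_bound (char_poly B)).
by move=> c /eigenvalue_bounded; apply: le_trans; exact: ler_norm.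
Qed.

Lemma eig_min_le (R : realType) n (B : 'M[R]_n) a :
  eigenvalue B a -> eig_min B <= a.
Proof.
move=> Ba; apply: ge_inf => //; exists (- cauchy_bound (char_poly B)).
by move=> c /eigenvalue_bounded; rewrite ler_norml => /andP[].
Qed.

Lemma eigenvalue_gt0 (R : realType) n (B : 'M[R]_n) a :
  spd B -> eigenvalue B a -> 0 < a.
Proof.
move=> spdB /eigenvalueP[v vB v0].
have vT0 : v^T != 0.
  by apply: contraNneq v0 => /(congr1 trmx); rewrite trmxK trmx0 => ->.
have := bform_gt0 spdB vT0.
rewrite /bform trmxK vB -scalemxAl mxE pmulr_lgt0 //.
by have := mul_trmx_gt0 vT0; rewrite trmxK.
Qed.

Lemma eig_max_ge0 (R : realType) n (B : 'M[R]_n) : spd B -> 0 <= eig_max B.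
Proof.
move=> spdB.
have [[[a Ba] _]|/sup_out] := pselect (has_sup [set a | eigenvalue B a]%classic).
  exact: le_trans (ltW (eigenvalue_gt0 spdB Ba)) (eig_max_ge Ba).
by rewrite /eig_max => ->.
Qed.

Lemma eig_min_ge0 (R : realType) n (B : 'M[R]_n) : spd B -> 0 <= eig_min B.
Proof.
move=> spdB.
have [[Bn0 _]|/inf_out] := pselect (has_inf [set a | eigenvalue B a]%classic).
  by apply: lb_le_inf Bn0 _ => a /(eigenvalue_gt0 spdB)/ltW.
by rewrite /eig_min => ->.
Qed.

(** * Kantorovich's inequality *)

(** The quadratic form of [B^j (L - B) (B - l)] at [w] is nonnegative, because
    every eigenvalue lies in [[l, L]]. *)
Lemma bform_exp_moments (R : realType) n (B : 'M[R]_n.+1) j w : spd B ->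
  bform (B ^+ j.+2) w w + eig_min B * eig_max B * bform (B ^+ j) w w
    <= (eig_max B + eig_min B) * bform (B ^+ j.+1) w w.
Proof.
move=> spdB; set l := eig_min B; set L := eig_max B.
pose p : {poly R} := 'X^j * ((L%:P - 'X) * ('X - l%:P)).
have p_ge0 a : eigenvalue B a -> 0 <= p.[a].
  move=> Ba; rewrite /p !hornerE; rewrite !mulr_ge0 ?subr_ge0 //.
  - exact/exprn_ge0/ltW/(eigenvalue_gt0 spdB).
  - exact: eig_max_ge.
  - exact: eig_min_le.
have := bform_horner_ge0 spdB.1 p_ge0 w.
have -> : p = (L + l) *: 'X^(j.+1) - 'X^(j.+2) - (l * L) *: 'X^j.
  rewrite /p -!mul_polyC !exprS polyCM polyCD; ring.
rewrite !(raddfB, linearB) /= !linearZ /= !rmorphXn /= horner_mx_X.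
rewrite scalerN /bform !(mulmxBr, mulmxBl) -!(scalemxAr, scalemxAl) !mxE.
lra.
Qed.

Lemma kantorovich (R : realType) n (B : 'M[R]_n.+1) j w : spd B ->
  4 * cond_num B / (cond_num B + 1) ^+ 2
      * (bform (B ^+ j) w w * bform (B ^+ j.+2) w w)
    <= bform (B ^+ j.+1) w w ^+ 2.
Proof.
move=> spdB; have := bform_exp_moments j w spdB; rewrite /cond_num.
have := eig_max_ge0 spdB; have := eig_min_ge0 spdB.
move: (eig_min B) (eig_max B) => l L.
set p := bform (B ^+ j) w w; set q := bform _ w w; set r := bform _ w w.
have : 0 <= p by apply/bform_ge0/spd_exp.
have : 0 <= q by apply/bform_ge0/spd_exp.
move=> q0 p0; rewrite le_eqVlt => /predU1P[<-|l0] L0 hqr.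
  (* At l = 0 the quotient L / l is 0, and the left-hand side vanishes. *)
  by rewrite invr0 mulr0 mulr0 !mul0r sqr_ge0.
have -> : 4 * (L / l) / (L / l + 1) ^+ 2 = 4 * l * L / (L + l) ^+ 2.
  by field; rewrite !gt_eqF ?ltr_wpDl.
rewrite mulrAC ler_pdivrMr ?exprn_gt0 ?ltr_wpDl // -exprMn.
have : (q + l * L * p) ^+ 2 <= (r * (L + l)) ^+ 2.
  rewrite ler_sqr ?nnegrE; first by rewrite [r * _]mulrC.
    by rewrite addr_ge0 // !mulr_ge0 // ltW.
  by rewrite mulr_ge0 ?addr_ge0 ?(ltW l0) //; apply/bform_ge0/spd_exp.
apply: le_trans; rewrite -subr_ge0.
have -> : (q + l * L * p) ^+ 2 - 4 * l * L * (p * q) = (q - l * L * p) ^+ 2.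
  by ring.
exact: sqr_ge0.
Qed.

(** * One step of the scheme *)

(** The subtracted vector is [omega] times the [H]-orthogonal projection [s]
    of [w] onto the column space of [V].  Pythagoras gives a decrease of
    [omega (2 - omega) |s|^2], and Cauchy-Schwarz bounds [|s|^2] below, since
    [s] and [w] have the same scalar product with each [V y].  The bound is
    multiplied by [|V y|^2] to avoid dividing by it. *)
Lemma relaxed_projection (R : realType) n m (H : 'M[R]_n) (V : 'M[R]_(n, m))
    (w : 'cV[R]_n) (y : 'cV[R]_m) omega :
    spd H -> \rank V = m -> 0 < omega < 2 ->
  let w' := w - omega *: (V *m (invmx (V^T *m H *m V) *m (V^T *m H *m w))) in
  bform H w' w' * bform H (V *m y) (V *m y) <=
    bform H w w * bform H (V *m y) (V *m y)
      - omega * (2 - omega) * bform H w (V *m y) ^+ 2.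
Proof.
move=> spdH rkV /andP[omega_gt0 omega_lt2] /=.
set s := V *m (invmx _ *m _).
have ortho z : bform H w (V *m z) = bform H s (V *m z).
  rewrite ![bform H _ (V *m z)]bform_sym ?spdH.1 // /bform trmx_mul.
  have unitM := spd_unitmx (spd_congr spdH rkV).
  have VHs : V^T *m H *m s = V^T *m H *m w by rewrite /s mulmxA mulKVmx.
  by rewrite -!mulmxA (mulmxA V^T H w) (mulmxA V^T H s) VHs.
(* s itself has the form V z, so <w, s> = <s, s>. *)
rewrite bform_subZ ?spdH.1 // {2}/s ortho -/s ortho.
have := bform_CauchySchwarz s (V *m y) spdH.
set a := bform H w w; set b := bform H s s; set c := bform H (V *m y) _.
move=> le_bc; rewrite -subr_ge0.
have : 0 <= omega * (2 - omega) * (b * c - bform H s (V *m y) ^+ 2).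
  by rewrite !mulr_ge0 ?subr_ge0 // ltW.
lra.
Qed.

(** The scalar product of [B ^+ j] turns the quantities [<w, B w>] and
    [|B w|^2] of the projection bound into the moments of orders [j.+1] and
    [j.+2], which Kantorovich's inequality compares. *)
Lemma projection_contraction (R : realType) n m (B : 'M[R]_n.+1)
    (V : 'M[R]_(n.+1, m)) (w : 'cV[R]_n.+1) j omega :
    spd B -> \rank V = m -> 0 < omega < 2 -> ((B *m w)^T <= V^T)%MS ->
  let H := B ^+ j in
  let w' := w - omega *: (V *m (invmx (V^T *m H *m V) *m (V^T *m H *m w))) in
  bform H w' w' <= conv_factor (cond_num B) omega * bform H w w.
Proof.
move=> spdB rkV homega /submxP[y /(congr1 trmx)]; rewrite trmxK trmx_mul trmxK.
move=> defBw; have spdH := spd_exp j spdB; set H := B ^+ j; move=> /=.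
set w' := w - _.
have [w0|w0] := eqVneq w 0.
  by rewrite /w' w0 !mulmx0 scaler0 subrr /bform !mulmx0 mxE mulr0 lexx.
have Bw_gt0 : 0 < bform H (B *m w) (B *m w).
  apply: bform_gt0 => //; apply: contraNneq w0 => Bw0.
  by rewrite -[w](mulKmx (spd_unitmx spdB)) Bw0 mulmx0.
rewrite -(ler_pM2r Bw_gt0) defBw.
have := relaxed_projection w y^T spdH rkV homega; rewrite /= -/w' -/H.
move/le_trans; apply; rewrite -defBw /conv_factor.
have symB := spdB.1.
have -> : bform H w (B *m w) = bform (B ^+ j.+1) w w.
  by rewrite /bform exprSr mulmxA -(mulmxA _ _ B).
have -> : bform H (B *m w) (B *m w) = bform (B ^+ j.+2) w w.
  by rewrite /bform trmx_mul symB exprSr exprS !mulmxA.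
rewrite -subr_ge0; set K := 4 * cond_num B / _.
have := kantorovich j w spdB; rewrite -/K -/H => kant.
have : 0 <= omega * (2 - omega) * (bform (B ^+ j.+1) w w ^+ 2
    - K * (bform H w w * bform (B ^+ j.+2) w w)).
  by case/andP: homega => o0 o2; rewrite !mulr_ge0 ?subr_ge0 // ltW.
lra.
Qed.

Lemma conv_factor_itv01 (R : realType) (kappa omega : R) :
  0 <= kappa -> 0 < omega < 2 -> 0 <= conv_factor kappa omega <= 1.
Proof.
move=> kappa0 /andP[o0 o2]; rewrite /conv_factor.
have K0 : 0 <= 4 * kappa / (kappa + 1) ^+ 2.
  by apply: divr_ge0; [exact: mulr_ge0 | exact: sqr_ge0].
have K1 : 4 * kappa / (kappa + 1) ^+ 2 <= 1.
  rewrite ler_pdivrMr ?exprn_gt0 ?ltr_wpDl // mul1r -subr_ge0.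
  have -> : (kappa + 1) ^+ 2 - 4 * kappa = (kappa - 1) ^+ 2 by ring.
  exact: sqr_ge0.
have t0 : 0 <= omega * (2 - omega) by rewrite mulr_ge0 ?subr_ge0 // ltW.
have t1 : omega * (2 - omega) <= 1.
  by rewrite -subr_ge0 (_ : _ - _ = (1 - omega) ^+ 2) ?sqr_ge0 //; ring.
by rewrite subr_ge0 mulr_ile1 //= gerBl mulr_ge0.
Qed.

(** * Convergence of the scheme *)

Theorem theorem10 (R : realType) (n : nat) (A : 'M[R]_n.+1) (b : 'cV[R]_n.+1)
    (Q : 'M[R]_n.+1) (l2 : nat) (omega : R)
    (m : nat -> nat) (W : forall k : nat, 'M[R]_(n.+1, m k))
    (x : nat -> 'cV[R]_n.+1)
    (hA : spd A) (hQ : Q \in unitmx) (homega : 0 < omega < 2)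
    (hx : flexible_scheme A Q b l2 omega W x) :
  let At := precond A Q in
  let gt := fun k : nat => precond_grad A Q b (x k) in
  let c := conv_factor (cond_num At) omega in
  forall k : nat,
    norm_mx (At ^ (l2%:Z - 1)) (gt k.+1) ^+ 2
      <= c ^+ k * norm_mx (At ^ (l2%:Z - 1)) (gt 0%N) ^+ 2.
Proof.
move=> At gt c k.
have spdAt : spd At by apply: spd_precond.
have unitAt := spd_unitmx spdAt.
(* e i is the error of x i, the minimizer being At^-1 Q b. *)
pose e i := invmx At *m gt i; pose H := At ^+ l2.+1.
have Ate i : At *m e i = gt i by rewrite mulKVmx.
have step i : bform H (e i.+1) (e i.+1) <= c * bform H (e i) (e i).
  have [_ rkW gW xS] := hx i; set V := Q *m W i.
  have rkV : \rank V = m i by rewrite eqmxMfull // row_full_unit.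
  have trV : V^T = (W i)^T *m Q^T by rewrite trmx_mul.
  (* Replacing gt i by At e i supplies the exponent l2.+1, so that the
     coefficients become those of a projection for H. *)
  have coefE : flex_coef A Q b l2 (W i) (x i) =
      invmx (V^T *m H *m V) *m (V^T *m H *m e i).
    by rewrite /flex_coef -/At -/(gt i) -Ate trV /V /H exprSr !mulmxA.
  have -> : e i.+1 =
      e i - omega *: (V *m (invmx (V^T *m H *m V) *m (V^T *m H *m e i))).
    rewrite -coefE /e /gt /precond_grad xS -/At !mulmxBr -!scalemxAr !mulKmx //.
    by rewrite addrAC.
  apply: projection_contraction => //.
  have -> : At *m e i = Q *m grad A b (Q^T *m x i).
    by rewrite Ate /gt /precond_grad /grad mulmxBr !mulmxA.
  by rewrite trV trmx_mul submxMr.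
have /andP[c0 c1] : 0 <= c <= 1.
  by apply: conv_factor_itv01 => //; rewrite divr_ge0 ?eig_max_ge0 ?eig_min_ge0.
have {}step i : bform H (e i) (e i) <= c ^+ i * bform H (e 0%N) (e 0%N).
  elim: i => [|i IH]; first by rewrite mul1r.
  by apply: le_trans (step i) _; rewrite exprS -mulrA ler_wpM2l.
rewrite !norm_mx_expz // -/H -!/(e _); apply: le_trans (step k.+1) _.
rewrite exprS -mulrA ler_piMl // mulr_ge0 ?exprn_ge0 //.
exact: bform_ge0 (spd_exp _ spdAt).
Qed.
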